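(* Let $k\ge 1$ be an integer. The Fibonacci number $F_k$ can be written as a product of three repdigits (in base $10$), i.e. $$F_k=d_1\frac{10^\ell-1}{9}\cdot d_2\frac{10^m-1}{9}\cdot d_3\frac{10^n-1}{9}$$ for some integers $1\le d_1,d_2,d_3\le 9$ and $1\le \ell\le m\le n$, if and only if $F_k\in\{1,2,3,5,8,21,55,144\}$.
   Context: $(F_n)_{n\ge 0}$ is the Fibonacci sequence: $F_0=0$, $F_1=1$, $F_{n+2}=F_{n+1}+F_n$. A repdigit is a positive integer all of whose decimal digits are equal, i.e. a number $d\frac{10^m-1}{9}$ with $m\ge 1$, $1\le d\le 9$. *)

(* Defs.v *)
From mathcomp Require Import all_boot.

Fixpoint fib (n : nat) : nat :=
  match n with
  | 0 => 0
  | S n' => match n' with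
            | 0 => 1
            | S n'' => fib n' + fib n''
            end
  end.

Definition repdigit (d m : nat) : nat := d * ((10 ^ m - 1) %/ 9).

(* Main.v *)
Require Import Defs.
From Stdlib Require Import NArith MSetPositive.
From mathcomp Require Import all_boot.

(** If a prime [q > 7] divides [F_k], it divides one of the three repunits, so
    the order of 10 mod [q] divides one of the exponents; conversely, if
    [q | R_e] for an exponent [e], the rank of apparition of [q] divides [k].
    Alternating these two moves shows that an exponent divisible by 3 or by 4
    forces [300 | k], hence [400 = 16 * 25 | F_k] and [400 | d1 d2 d3], which
    is impossible.  For the other exponents the equation is solved modulo
    [Q = 2^5 * 5^2 * 7 * 11 * 13 * 101]: Fibonacci numbers have period 8400
    and repunits have period 12 from [R_5] on, so only finitely many cases
    remain.  No residue survives if some exponent exceeds 2, and otherwise the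
    right-hand side is smaller than [Q], so that its residue determines it. *)

Set Implicit Arguments.
Unset Strict Implicit.
Unset Printing Implicit Defensive.

(** * Periodic orbits and divisibility *)

Section Orbits.

Variables (T : Type) (f : T -> T) (x : T) (p : nat).
Hypothesis fpx : iter p f x = x.

Lemma iter_modn n : iter n f x = iter (n %% p) f x.
Proof.
rewrite {1}(divn_eq n p) addnC iterD; congr (iter _ f _).
by elim: (n %/ p) => // m IHm; rewrite mulSn iterD IHm.
Qed.

(** Checking one period suffices: as [z] divides [p], reducing [n] modulo [p] does not change
    whether [z] divides it. *)
Lemma iter_pred_dvdn (P : pred T) z n : 0 < p -> z %| p ->
  all (fun i => P (iter i f x) == (z %| i)) (iota 0 p) ->
  P (iter n f x) = (z %| n).
Proof.
move=> p_gt0 zp /allP chk; rewrite iter_modn {2}(divn_eq n p) dvdn_addr.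
  by apply/eqP/chk; rewrite mem_iota ltn_pmod.
exact: dvdn_mull.
Qed.

End Orbits.

Lemma dvdn_of_nat q x :
  (N.to_nat q %| x) = (N.modulo (N.of_nat x) q == 0%num).
Proof.
apply/idP/eqP => [/dvdnP[y ->] | /N.Lcm0.mod_divide[y xy]].
  by rewrite Nat2N.inj_mul N2Nat.id N.Div0.mod_mul.
by apply/dvdnP; exists (N.to_nat y); rewrite -(Nat2N.id x) xy N2Nat.inj_mul.
Qed.

(** * Fibonacci numbers and repunits modulo [q], computed in binary *)

Definition fib_step (q : N) (ab : N * N) : N * N :=
  (ab.2, N.modulo (N.add ab.1 ab.2) q).

Lemma iter_fib_step q k : (1 < q)%num ->
  iter k (fib_step q) (0%num, 1%num) =
  (N.modulo (N.of_nat (fib k)) q, N.modulo (N.of_nat (fib k.+1)) q).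
Proof.
move=> q_gt1; elim: k => [|k IHk].
  by rewrite [LHS]/= N.Div0.mod_0_l N.mod_small.
rewrite iterS IHk /fib_step; congr (_, _).
rewrite -[fib k.+2]/(fib k.+1 + fib k) addnC Nat2N.inj_add.
by rewrite [in RHS]N.Div0.add_mod.
Qed.

(** Here [z] is the rank of apparition of [q], and [p] is a period of the pairs of consecutive
    Fibonacci numbers modulo [q], which may be a proper multiple of [z]. *)
Lemma dvdn_fib q z p k : (1 < q)%num -> 0 < p -> z %| p ->
  iter p (fib_step q) (0%num, 1%num) = (0%num, 1%num) ->
  all (fun i => ((iter i (fib_step q) (0%num, 1%num)).1 == 0%num) == (z %| i))
      (iota 0 p) ->
  (N.to_nat q %| fib k) = (z %| k).
Proof.
move=> q_gt1 p_gt0 zp per chk.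
rewrite -(iter_pred_dvdn per k (P := fun ab => ab.1 == 0%num) p_gt0 zp chk).
by rewrite iter_fib_step // dvdn_of_nat.
Qed.

Definition repunit n := (10 ^ n - 1) %/ 9.

Lemma repunitS n : repunit n.+1 = 10 * repunit n + 1.
Proof.
have repunitM m : repunit m * 9 = 10 ^ m - 1.
  by rewrite divnK // -(exp1n m) subn_exp dvdn_mulr.
apply/eqP; rewrite -(eqn_pmul2r (isT : 0 < 9)) mulnDl -mulnA !repunitM.
rewrite mulnBr -expnS -[X in _ + X]/(10 - 1) addnBA // subnK //.
by rewrite expnS leq_mul // expn_gt0.
Qed.

Definition repunit_step (q r : N) : N := N.modulo (N.add (N.mul 10 r) 1) q.

Lemma iter_repunit_step q n : (1 < q)%num ->
  iter n (repunit_step q) 0%num = N.modulo (N.of_nat (repunit n)) q.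
Proof.
move=> q_gt1; elim: n => [|n IHn]; first by rewrite N.Div0.mod_0_l.
rewrite iterS IHn repunitS Nat2N.inj_add Nat2N.inj_mul /repunit_step.
rewrite -N.Div0.add_mod_idemp_l N.Div0.mul_mod_idemp_r.
by rewrite N.Div0.add_mod_idemp_l.
Qed.

Lemma dvdn_repunit q z n : (1 < q)%num -> 0 < z ->
  iter z (repunit_step q) 0%num = 0%num ->
  all (fun i => (iter i (repunit_step q) 0%num == 0%num) == (z %| i))
      (iota 0 z) ->
  (N.to_nat q %| repunit n) = (z %| n).
Proof.
move=> q_gt1 z_gt0 per chk.
rewrite -(iter_pred_dvdn per n (P := pred1 0%num) z_gt0 (dvdnn z) chk) /=.
by rewrite iter_repunit_step // dvdn_of_nat.
Qed.

Lemma dvd16_fib k : (16 %| fib k) = (12 %| k).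
Proof. by apply: (@dvdn_fib 16 _ 24); vm_compute. Qed.
Lemma dvd25_fib k : (25 %| fib k) = (25 %| k).
Proof. by apply: (@dvdn_fib 25 _ 100); vm_compute. Qed.
Lemma dvd31_fib k : (31 %| fib k) = (30 %| k).
Proof. by apply: (@dvdn_fib 31 _ 30); vm_compute. Qed.
Lemma dvd37_fib k : (37 %| fib k) = (19 %| k).
Proof. by apply: (@dvdn_fib 37 _ 76); vm_compute. Qed.
Lemma dvd41_fib k : (41 %| fib k) = (20 %| k).
Proof. by apply: (@dvdn_fib 41 _ 40); vm_compute. Qed.
Lemma dvd101_fib k : (101 %| fib k) = (50 %| k).
Proof. by apply: (@dvdn_fib 101 _ 50); vm_compute. Qed.
Lemma dvd113_fib k : (113 %| fib k) = (19 %| k).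
Proof. by apply: (@dvdn_fib 113 _ 76); vm_compute. Qed.
Lemma dvd151_fib k : (151 %| fib k) = (50 %| k).
Proof. by apply: (@dvdn_fib 151 _ 50); vm_compute. Qed.

Lemma dvd31_repunit n : (31 %| repunit n) = (15 %| n).
Proof. by apply: (@dvdn_repunit 31); vm_compute. Qed.
Lemma dvd37_repunit n : (37 %| repunit n) = (3 %| n).
Proof. by apply: (@dvdn_repunit 37); vm_compute. Qed.
Lemma dvd41_repunit n : (41 %| repunit n) = (5 %| n).
Proof. by apply: (@dvdn_repunit 41); vm_compute. Qed.
Lemma dvd101_repunit n : (101 %| repunit n) = (4 %| n).
Proof. by apply: (@dvdn_repunit 101); vm_compute. Qed.
Lemma dvd113_repunit n : (113 %| repunit n) = (112 %| n).
Proof. by apply: (@dvdn_repunit 113); vm_compute. Qed.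
Lemma dvd151_repunit n : (151 %| repunit n) = (75 %| n).
Proof. by apply: (@dvdn_repunit 151); vm_compute. Qed.

Lemma coprime10_repunit n : 0 < n -> coprime 10 (repunit n).
Proof. by case: n => // n _; rewrite /coprime repunitS mulnC gcdnMDl. Qed.

(** * Excluding exponents divisible by 3 or by 4 *)

Section Cascade.

Variables (k d1 d2 d3 l m n : nat).
Hypotheses (d1P : 1 <= d1 <= 9) (d2P : 1 <= d2 <= 9) (d3P : 1 <= d3 <= 9).
Hypotheses (l_gt0 : 0 < l) (m_gt0 : 0 < m) (n_gt0 : 0 < n).
Hypothesis fibE :
  fib k = d1 * d2 * d3 * (repunit l * repunit m * repunit n).

Let es := [:: l; m; n].

Lemma repunit_dvd_fib e : e \in es -> repunit e %| fib k.
Proof.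
rewrite !inE fibE => /or3P[] /eqP ->; apply: dvdn_mull.
- by rewrite -mulnA dvdn_mulr.
- by rewrite dvdn_mulr // dvdn_mull.
- exact: dvdn_mull.
Qed.

Lemma prime_dvd_repunit q : prime q -> 9 < q -> q %| fib k ->
  exists2 e, e \in es & q %| repunit e.
Proof.
move=> q_pr q_gt9.
have ndvd d : 1 <= d <= 9 -> (q %| d) = false.
  by case/andP=> d_gt0 d_le9; rewrite gtnNdvd // (leq_ltn_trans d_le9).
rewrite fibE !Euclid_dvdM // (ndvd d1) // (ndvd d2) // (ndvd d3) //=.
case/orP=> [/orP[]|] qe.
- by exists l => //; rewrite inE eqxx.
- by exists m => //; rewrite !inE eqxx orbT.
- by exists n => //; rewrite !inE eqxx !orbT.
Qed.

Lemma dvd300_absurd : 300 %| k -> False.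
Proof.
move=> k300.
have: 16 * 25 %| fib k.
  rewrite Gauss_dvd // dvd16_fib dvd25_fib.
  by rewrite !(dvdn_trans _ k300).
have cop e : 0 < e -> coprime (16 * 25) (repunit e).
  move=> /coprime10_repunit; rewrite (@coprimeMl _ 2 5) => /andP[cop2 cop5].
  by rewrite coprimeMl (coprimeXl 4 cop2) (coprimeXl 2 cop5).
rewrite fibE Gauss_dvdl ?coprimeMr ?cop //.
(* A factor 25 forces two of the digits to be 5, and the third cannot be a multiple of 16. *)
have chk : all (fun a => all (fun b => all (fun c => ~~ (16 * 25 %| a * b * c))
  (iota 1 9)) (iota 1 9)) (iota 1 9) by vm_compute.
have digit d : 1 <= d <= 9 -> d \in iota 1 9 by rewrite mem_iota.
apply/negP; move: d1 d2 d3 (digit d1 d1P) (digit d2 d2P) (digit d3 d3P).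
by move=> a b c aP bP cP; exact: (allP (allP (allP chk a aP) b bP) c cP).
Qed.

(** The primes 101 and 151 share the rank 50. So [4 %| e] gives 101, then [50 %| k], then 151, then
    an exponent [e'] divisible by 75; its repunit is divisible by 31 and 41, of ranks 30 and 20, and
    the lcm of 50, 30 and 20 is 300. *)
Lemma ndvd4_exponent e : e \in es -> (4 %| e) = false.
Proof.
move=> e_in; apply/negP; rewrite -dvd101_repunit => /dvdn_trans.
move/(_ _ (repunit_dvd_fib e_in)); rewrite dvd101_fib => k50.
have := k50; rewrite -dvd151_fib => /prime_dvd_repunit[] // e' e'_in.
rewrite dvd151_repunit => e'75.
have k30 : 30 %| k.
  rewrite -dvd31_fib (dvdn_trans _ (repunit_dvd_fib e'_in)) //.
  by rewrite dvd31_repunit (dvdn_trans _ e'75).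
have k20 : 20 %| k.
  rewrite -dvd41_fib (dvdn_trans _ (repunit_dvd_fib e'_in)) //.
  by rewrite dvd41_repunit (dvdn_trans _ e'75).
apply: dvd300_absurd.
by rewrite -[300]/(lcmn 50 (lcmn 30 20)) !dvdn_lcm k50 k30.
Qed.

(** The primes 37 and 113 share the rank 19, and 10 has order 112 modulo 113, so some exponent is
    divisible by 4. *)
Lemma ndvd3_exponent e : e \in es -> (3 %| e) = false.
Proof.
move=> e_in; apply/negP; rewrite -dvd37_repunit => /dvdn_trans.
move/(_ _ (repunit_dvd_fib e_in)); rewrite dvd37_fib -dvd113_fib.
case/prime_dvd_repunit=> // e' e'_in; rewrite dvd113_repunit => e'112.
by have := ndvd4_exponent e'_in; rewrite (dvdn_trans _ e'112).
Qed.

End Cascade.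

(** * The finite search modulo [Q] *)

Definition Q : N := 80880800.

(** A binary trie makes the many membership tests fast; its keys are positive, so residues are
    shifted by one. *)
Definition fst_set (s : seq (N * N)) : PositiveSet.t :=
  foldr (fun ab => PositiveSet.add (N.succ_pos ab.1)) PositiveSet.empty s.

(** The length 8400 is the lcm of the periods 48, 100, 16, 10, 28, 50 modulo 32, 25, 7, 11, 13,
    101. *)
Definition fib_residues : PositiveSet.t :=
  fst_set (traject (fib_step Q) (0%num, 1%num) (84 * 100)).

Definition is_fib_residue (x : N) : bool :=
  PositiveSet.mem (N.succ_pos x) fib_residues.

Lemma mem_fst_set ab (s : seq (N * N)) :
  ab \in s -> PositiveSet.mem (N.succ_pos ab.1) (fst_set s).
Proof.
elim: s => // cd s IHs; rewrite inE.
case/predU1P=> [-> | /IHs/PositiveSet.mem_spec in_s];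
  apply/PositiveSet.mem_spec/PositiveSet.add_spec; first [by left | by right].
Qed.

Lemma looping_fib : looping (fib_step Q) (0%num, 1%num) (84 * 100).
Proof. by vm_compute. Qed.

Lemma is_fib_residue_fib k : is_fib_residue (N.modulo (N.of_nat (fib k)) Q).
Proof.
have := mem_fst_set (loopingP looping_fib k).
by rewrite (iter_fib_step k (erefl : (1 < Q)%num)).
Qed.

Definition digit_products : seq N :=
  let s := map N.of_nat (iota 1 9) in
  undup [seq N.mul x c | x <- [seq N.mul a b | a <- s, b <- s], c <- s].

Lemma digit_productsP d1 d2 d3 : 1 <= d1 <= 9 -> 1 <= d2 <= 9 -> 1 <= d3 <= 9 ->
  N.of_nat (d1 * d2 * d3) \in digit_products.
Proof.
move=> d1P d2P d3P; rewrite mem_undup !Nat2N.inj_mul.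
by do 2!rewrite ?allpairs_f //; rewrite map_f // mem_iota.
Qed.

(** The exponents represent the classes modulo 12 that avoid the multiples of
    3 and 4, shifted past the preperiod. *)
Definition large_residues : seq N :=
  [seq iter i (repunit_step Q) 0%num | i <- [:: 5; 7; 10; 11; 13; 14]].

Definition residues : seq N := [:: 1%num, 11%num & large_residues].

Lemma large_residuesP n : 2 < n -> (3 %| n) = false -> (4 %| n) = false ->
  N.modulo (N.of_nat (repunit n)) Q \in large_residues.
Proof.
move=> n_gt2 n3 n4; rewrite -iter_repunit_step //.
(* The values 3 and 4 are themselves excluded, so [n] is past the preperiod, which comes from the
   factor 32 of [Q]. *)
have n_ge5 : 4 < n by case: n n_gt2 n3 n4 => [|[|[|[|[]]]]].
move: n3 n4; rewrite -(subnK n_ge5) iterD.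
set x5 := iter 5 _ _; have per : iter 12 (repunit_step Q) x5 = x5 by vm_compute.
have chk : all (fun i => [|| 3 %| i + 5, 4 %| i + 5 |
    iter i (repunit_step Q) x5 \in large_residues]) (iota 0 12) by vm_compute.
rewrite (iter_modn per) {1 2}(divn_eq (n - 5) 12) -addnA.
have dvd12 d : d %| 12 -> d %| (n - 5) %/ 12 * 12 by apply: dvdn_mull.
rewrite (dvdn_addr _ (dvd12 3 isT)) (dvdn_addr _ (dvd12 4 isT)) => n3 n4.
have /(allP chk) : (n - 5) %% 12 \in iota 0 12 by rewrite mem_iota ltn_pmod.
by rewrite n3 n4.
Qed.

Lemma residuesP n : 0 < n -> (3 %| n) = false -> (4 %| n) = false ->
  N.modulo (N.of_nat (repunit n)) Q \in residues.
Proof.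
have [n_gt2 _ n3 n4 | ] := ltnP 2 n.
  by rewrite /residues 2!in_cons large_residuesP ?orbT.
by case: n => [|[|[]]].
Qed.

Definition mulQ (x y : N) : N := N.modulo (N.mul x y) Q.

Lemma mulQ_of_nat a b :
  mulQ (N.modulo (N.of_nat a) Q) (N.modulo (N.of_nat b) Q) =
  N.modulo (N.of_nat (a * b)) Q.
Proof. by rewrite /mulQ -N.Div0.mul_mod Nat2N.inj_mul. Qed.

(** Only the last factor is restricted to [large_residues]: it stands for the largest exponent [n],
    while [l] and [m] may still be 1 or 2. *)
Definition large_products : seq N :=
  [seq mulQ xy z | xy <- undup [seq mulQ x y | x <- residues, y <- residues],
                   z <- large_residues].

Lemma no_large_solution :
  all (fun r => all (fun d => ~~ is_fib_residue (mulQ d r)) digit_products)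
      large_products.
Proof. by vm_compute. Qed.

Definition solutions : seq nat := [:: 1; 2; 3; 5; 8; 21; 55; 144].

(** The second list holds the products of three factors from 1 and 11. The largest value, 729 * 1331
    = 970299, is below [Q]. *)
Lemma small_solutions :
  all (fun d => all (fun r => (N.modulo (N.mul d r) Q == N.mul d r) &&
      (is_fib_residue (N.mul d r) ==> (N.mul d r \in map N.of_nat solutions)))
    [:: 1; 11; 121; 1331]%num) digit_products.
Proof. by vm_compute. Qed.

Theorem theorem3p3 (k : nat) : 1 <= k ->
  (exists d1 d2 d3 l m n : nat,
      (1 <= d1 <= 9) /\ (1 <= d2 <= 9) /\ (1 <= d3 <= 9) /\
      (1 <= l) /\ (l <= m) /\ (m <= n) /\
      fib k = repdigit d1 l * repdigit d2 m * repdigit d3 n)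
  <-> fib k \in [:: 1; 2; 3; 5; 8; 21; 55; 144].
Proof.
move=> _; split; last first.
  rewrite !inE => /or4P[||| /or4P[| | | /orP[]]] /eqP->.
  - by exists 1, 1, 1, 1, 1, 1.
  - by exists 1, 1, 2, 1, 1, 1.
  - by exists 1, 1, 3, 1, 1, 1.
  - by exists 1, 1, 5, 1, 1, 1.
  - by exists 1, 1, 8, 1, 1, 1.
  - by exists 1, 3, 7, 1, 1, 1.
  (* The only value that needs a repunit other than 1: 55 = 5 * 11. *)
  - by exists 1, 1, 5, 1, 1, 2.
  - by exists 2, 8, 9, 1, 1, 1.
case=> [d1 [d2 [d3 [l [m [n [d1P [d2P [d3P [l_gt0 [le_lm [le_mn fibE]]]]]]]]]]]].
have m_gt0 := leq_trans l_gt0 le_lm; have n_gt0 := leq_trans m_gt0 le_mn.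
have {}fibE : fib k = d1 * d2 * d3 * (repunit l * repunit m * repunit n).
  by rewrite fibE mulnACA (mulnACA d1 (repunit l)).
have ndvd e : e \in [:: l; m; n] -> (3 %| e) = false /\ (4 %| e) = false.
  move=> e_in; split.
    exact: (ndvd3_exponent d1P d2P d3P l_gt0 m_gt0 n_gt0 fibE e_in).
  exact: (ndvd4_exponent d1P d2P d3P l_gt0 m_gt0 n_gt0 fibE e_in).
have [l3 l4] := ndvd l (mem_head _ _).
have [m3 m4] : (3 %| m) = false /\ (4 %| m) = false.
  by apply: ndvd; rewrite !inE eqxx orbT.
have [n3 n4] : (3 %| n) = false /\ (4 %| n) = false.
  by apply: ndvd; rewrite !inE eqxx !orbT.
have dP := digit_productsP d1P d2P d3P.
have := is_fib_residue_fib k; rewrite fibE.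
have [n_gt2 | n_le2] := ltnP 2 n.
  have rP : N.modulo (N.of_nat (repunit l * repunit m * repunit n)) Q
            \in large_products.
    rewrite -mulQ_of_nat -(mulQ_of_nat (repunit l)).
    apply: allpairs_f (large_residuesP n_gt2 n3 n4).
    rewrite mem_undup.
    exact: allpairs_f (residuesP l_gt0 l3 l4) (residuesP m_gt0 m3 m4).
  have /negPf := allP (allP no_large_solution _ rP) _ dP.
  by rewrite /mulQ N.Div0.mul_mod_idemp_r -Nat2N.inj_mul => ->.
have small e : 0 < e -> e <= 2 -> repunit e = 1 \/ repunit e = 11.
  by case: e => [|[|[|]]] // _ _; [left | right].
have rP : N.of_nat (repunit l * repunit m * repunit n)
          \in [:: 1; 11; 121; 1331]%num.
  have m_le2 := leq_trans le_mn n_le2; have l_le2 := leq_trans le_lm m_le2.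
  by case: (small l l_gt0 l_le2) => ->; case: (small m m_gt0 m_le2) => ->;
     case: (small n n_gt0 n_le2) => ->.
have /andP[/eqP drQ dr_sol] := allP (allP small_solutions _ dP) _ rP.
rewrite Nat2N.inj_mul drQ => /(implyP dr_sol).
by rewrite -Nat2N.inj_mul (mem_map Nat2N.inj).
Qed.
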